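(* Let $\mu$ and $\nu$ be two positive real probability measures that are absolutely continuous with respect to one another and such that $$\int \Big(\frac{d\mu}{d\nu}\Big)^2 d\nu<\infty .$$ Let $\{\alpha_n\}$ and $\{\beta_n\}$ be families of polynomials orthogonal with respect to $\mu$ and $\nu$ respectively, and suppose that the connection coefficients $c_{n,k}$ ($0\le k\le n$) between them, defined by $$\beta_n(x)=\sum_{k=0}^{n}c_{n,k}\,\alpha_k(x),$$ are known. Then the expansion $$\frac{d\mu}{d\nu}(x)=\sum_{n\ge 0}a_n\beta_n(x),\qquad a_n=\frac{c_{n,0}}{\hat\beta_n},\qquad \hat\beta_n=\int\beta_n^2\,d\nu,$$ is convergent in $L^2(\mathbb{R},d\nu)$, that is, in the mean-square sense (mod $\nu$).
   Context: $\frac{d\mu}{d\nu}$ denotes the Radon-Nikodym derivative of $\mu$ with respect to $\nu$. The polynomials $\alpha_n,\beta_n$ have degree $n$, $n\ge0$, and $\alpha_0=1$.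
   Formalization: The series is shown to equal dμ/dν in L²(dν) when polynomials are dense in L²(dν); without density (e.g. ν log-normal, where the equality can fail) it is shown to converge in L²(dν) to a sum S with dμ/dν − S orthogonal to every polynomial. *)

(* Defs.v *)
From HB Require Import structures.
From mathcomp Require Export all_boot all_order all_algebra.
From mathcomp Require Export all_classical all_reals all_analysis.

Set Implicit Arguments.
Unset Strict Implicit.
Unset Printing Implicit Defensive.

Import Order.TTheory GRing.Theory Num.Theory.
Import numFieldNormedType.Exports.

Local Open Scope classical_set_scope.
Local Open Scope ring_scope.
Local Open Scope charge_scope.

(* The library's derivative takes values in the extended reals, but is finite
   everywhere when [mu `<< nu], so that [fine] loses nothing. *)
Definition RN_derivative (R : realType)
    (mu nu : probability (measurableTypeR R) R) (x : R) : R :=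
  fine (('d (charge_of_finite_measure mu) '/d nu) x).

(* Square-integrability makes all the integrals below meaningful.  The norms
   are not required to be nonzero: if [m] has finite support, the polynomials
   of large degree vanish [m]-almost everywhere. *)
Definition orthogonal_polynomials (R : realType)
    (m : probability (measurableTypeR R) R) (p : nat -> {poly R}) : Prop :=
  [/\ forall n, size (p n) = n.+1,
      forall n, horner (p n) \in Lfun m 2%:E &
      forall i j, i != j -> \int[m]_x ((p i).[x] * (p j).[x]) = 0].

Definition cvg_L2 (R : realType) (m : probability (measurableTypeR R) R)
    (u : nat -> R -> R) (f : R -> R) : Prop :=
  'N[m]_2%:E[EFin \o (u n \- f)%R]%E @[n --> \oo] --> 0%E.

(* This can fail, e.g. for the log-normal law; then the expansion of a density
   only recovers its projection on the closure of the polynomials. *)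
Definition polynomials_dense_L2 (R : realType)
    (m : probability (measurableTypeR R) R) : Prop :=
  forall f : R -> R, f \in Lfun m 2%:E -> forall e : R, 0 < e ->
  exists p : {poly R}, ('N[m]_2%:E[EFin \o (horner p \- f)%R] < e%:E)%E.

(* Where [sqnorm nu beta n] vanishes, so does [beta n] [nu]-almost everywhere,
   and the value of the coefficient is irrelevant. *)
Definition sqnorm (R : realType) (m : probability (measurableTypeR R) R)
    (p : nat -> {poly R}) (n : nat) : R :=
  \int[m]_x ((p n).[x] ^+ 2).

Definition expansion_coef (R : realType)
    (nu : probability (measurableTypeR R) R) (beta : nat -> {poly R})
    (c : nat -> nat -> R) (n : nat) : R :=
  c n 0%N / sqnorm nu beta n.

Definition expansion_sum (R : realType)
    (nu : probability (measurableTypeR R) R) (beta : nat -> {poly R})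
    (c : nat -> nat -> R) (N : nat) (x : R) : R :=
  \sum_(0 <= n < N) expansion_coef nu beta c n * (beta n).[x].

(* Main.v *)
Require Import Defs.
From mathcomp Require Import all_boot all_order all_algebra.
From mathcomp Require Import all_classical all_reals all_analysis.
From mathcomp Require Import measurable_realfun ring lra.
Import Order.TTheory GRing.Theory Num.Theory.
Import numFieldNormedType.Exports.
Local Open Scope classical_set_scope.
Local Open Scope ring_scope.
Local Open Scope charge_scope.

Set Implicit Arguments.
Unset Strict Implicit.
Unset Printing Implicit Defensive.

(** With [f] the density, the change of variables
    [\int f * beta_n dnu = \int beta_n dmu = c n 0] (only [alpha_0 = 1] has a
    nonzero [mu]-mean) shows that the [a_n] are the Fourier coefficients of [f]
    in [L2(nu)].  So the partial sums are the orthogonal projections of [f] on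
    the polynomials of degree [< N].  Bessel's inequality makes them Cauchy,
    hence convergent; when polynomials are dense, best approximation forces the
    limit to be [f]. *)

(** * The pre-Hilbert structure of real L2 *)

Section inner_product.
Context d (T : measurableType d) (R : realType).
Variable mu : {measure set T -> \bar R}.
Implicit Types f g h : T -> R.

Local Notation L2 := (Lfun mu 2%:E).

(** A real-valued integral hides divergence behind a default value; the membership hypotheses below
    supply the integrability that linearity requires. *)
Definition inner f g : R := \int[mu]_x (f x * g x).
Local Notation "<< f , g >>" := (inner f g).

Lemma L2_measurable f : f \in L2 -> measurable_fun setT f.
Proof. by rewrite inE => /andP[/[!inE]]. Qed.

Lemma L2_0 : (0 : T -> R) \in L2.
Proof. by have [] := @Lfun_submod_closed _ _ _ mu 2%:E (lee1n 2). Qed.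

Lemma L2_scaleD a f g : f \in L2 -> g \in L2 -> a *: f + g \in L2.
Proof. by have [_] := @Lfun_submod_closed _ _ _ mu 2%:E (lee1n 2); exact. Qed.

Lemma L2_scale a f : f \in L2 -> a *: f \in L2.
Proof. by move=> f2; rewrite -[_ *: _]addr0 L2_scaleD// L2_0. Qed.

Lemma L2_add f g : f \in L2 -> g \in L2 -> f + g \in L2.
Proof. by move=> f2 g2; rewrite -[f]scale1r L2_scaleD. Qed.

Lemma L2_sub f g : f \in L2 -> g \in L2 -> f - g \in L2.
Proof. by move=> f2 g2; rewrite addrC -scaleN1r L2_scaleD. Qed.

Lemma L2_sum (I : Type) (r : seq I) (P : pred I) (F : I -> T -> R) :
  (forall i, F i \in L2) -> \sum_(i <- r | P i) F i \in L2.
Proof.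
by move=> F2; elim/big_ind: _ => [|f g|//]; [exact: L2_0|exact: L2_add].
Qed.

Lemma inner_integrable f g : f \in L2 -> g \in L2 ->
  mu.-integrable setT (fun x => (f x * g x)%:E).
Proof. by move=> f2 g2; apply/Lfun1_integrable; exact: Lfun2_mul_Lfun1. Qed.

Lemma innerC f g : << f, g >> = << g, f >>.
Proof. by apply: eq_Rintegral => x _; rewrite mulrC. Qed.

Lemma inner_scaleDl a f g h : f \in L2 -> g \in L2 -> h \in L2 ->
  << a *: f + g, h >> = a * << f, h >> + << g, h >>.
Proof.
move=> f2 g2 h2; rewrite /inner -RintegralZl//; last exact: inner_integrable.
rewrite -RintegralD//; last 2 first.
- have := inner_integrable (L2_scale a f2) h2.
  by apply: eq_integrable => // x _ /=; rewrite mulrA.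
- exact: inner_integrable.
by apply: eq_Rintegral => x _; rewrite mulrA -mulrDl.
Qed.

Lemma inner0l h : << 0, h >> = 0.
Proof.
rewrite /inner (@eq_Rintegral _ _ _ _ _ (cst 0)) => [|x _]; last by rewrite mul0r.
by rewrite Rintegral_cst// mul0r.
Qed.

Lemma inner_scalel a f h : f \in L2 -> h \in L2 ->
  << a *: f, h >> = a * << f, h >>.
Proof.
move=> f2 h2; rewrite -[a *: f]addr0 inner_scaleDl// ?inner0l ?addr0//.
exact: L2_0.
Qed.

Lemma innerDl f g h : f \in L2 -> g \in L2 -> h \in L2 ->
  << f + g, h >> = << f, h >> + << g, h >>.
Proof. by move=> *; rewrite -[f]scale1r inner_scaleDl// scale1r mul1r. Qed.

Lemma innerBl f g h : f \in L2 -> g \in L2 -> h \in L2 ->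
  << f - g, h >> = << f, h >> - << g, h >>.
Proof. by move=> *; rewrite addrC -scaleN1r inner_scaleDl// mulN1r addrC. Qed.

Lemma inner_suml (I : Type) (r : seq I) (P : pred I) (F : I -> T -> R) h :
  (forall i, F i \in L2) -> h \in L2 ->
  << \sum_(i <- r | P i) F i, h >> = \sum_(i <- r | P i) << F i, h >>.
Proof.
move=> F2 h2; elim: r => [|i r IH]; first by rewrite !big_nil inner0l.
by rewrite !big_cons; case: ifP => // _; rewrite innerDl ?IH// L2_sum.
Qed.

Lemma inner_ge0 f : 0 <= << f, f >>.
Proof. by apply: Rintegral_ge0 => x _; rewrite -expr2 sqr_ge0. Qed.

Lemma inner_sqrD f g : f \in L2 -> g \in L2 ->
  << f + g, f + g >> = << f, f >> + 2 * << f, g >> + << g, g >>.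
Proof.
move=> f2 g2; rewrite innerDl ?L2_add// ![<< _, f + g >>]innerC !innerDl//.
rewrite [<< g, f >>]innerC; ring.
Qed.

(** The quadratic polynomial [t] to [<< t f + g, t f + g >>] is nonnegative, so its discriminant is
    at most 0. Its leading coefficient may vanish. *)
Lemma Cauchy_Schwarz f g : f \in L2 -> g \in L2 ->
  << f, g >> ^+ 2 <= << f, f >> * << g, g >>.
Proof.
move=> f2 g2; pose p := Poly [:: << g, g >>; 2 * << f, g >>; << f, f >>].
have p0 t : 0 <= p.[t].
  have := inner_ge0 (t *: f + g).
  rewrite inner_sqrD ?L2_scale// inner_scalel ?L2_scale//.
  rewrite inner_scalel// innerC inner_scalel//.
  rewrite /p horner_Poly /=; move/le_trans; apply; lra.
have sp : (size p <= 3)%N := size_Poly _.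
have := deg_le2_poly_ge0 sp p0.
by rewrite !coef_Poly /=; nra.
Qed.

Lemma L2P f : measurable_fun setT f ->
  (\int[mu]_x ((f x) ^+ 2)%:E < +oo)%E -> f \in L2.
Proof.
move=> mf f2; rewrite inE; apply/andP; split; rewrite inE//=.
rewrite /finite_norm unlock poweR_lty//.
under eq_integral => x _ do rewrite /= powR_mulrn// -normrX ger0_norm ?sqr_ge0//.
exact: f2.
Qed.

Lemma inner_sqrE f : f \in L2 -> (\int[mu]_x ((f x) ^+ 2)%:E = (<< f, f >>)%:E)%E.
Proof.
move=> f2; rewrite /inner /Rintegral fineK//.
exact: integrable_fin_num (inner_integrable f2 f2).
Qed.

(** Links the extended-real norm of [cvg_L2] and [polynomials_dense_L2] to the real inner product,
    in which all estimates are made. *)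
Lemma Lnorm2E f : f \in L2 ->
  ('N[mu]_2%:E[EFin \o f] = (Num.sqrt << f, f >>)%:E)%E.
Proof.
move=> f2; rewrite -powR12_sqrt ?inner_ge0// unlock -poweR_EFin -inner_sqrE//; congr (_ `^ _)%E.
by apply: eq_integral => x _ /=; rewrite powR_mulrn// -normrX ger0_norm ?sqr_ge0.
Qed.

End inner_product.

(** * Fourier expansions along an orthogonal, not normalized, family *)

Section orthogonal_expansion.
Context d (T : measurableType d) (R : realType).
Variable mu : {measure set T -> \bar R}.
Local Notation L2 := (Lfun mu 2%:E).
Local Notation "<< f , g >>" := (inner mu f g).

Variables (b : nat -> T -> R) (a : nat -> R) (f : T -> R).
Hypothesis b2 : forall n, b n \in L2.
Hypothesis b_orth : forall i j, i != j -> << b i, b j >> = 0.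
Hypothesis f2 : f \in L2.
(** The product form, instead of a quotient, allows [b n] of norm zero; [a n] is then arbitrary. *)
Hypothesis aE : forall n, a n * << b n, b n >> = << f, b n >>.

Let block m n := \sum_(m <= i < n) a i *: b i.

Let block2 m n : block m n \in L2.
Proof. by apply: L2_sum => i; exact: L2_scale. Qed.

Let inner_block_basis m n k : (m <= k < n)%N ->
  << block m n, b k >> = a k * << b k, b k >>.
Proof.
move=> mkn; rewrite inner_suml => [|i|//]; last exact: L2_scale.
under eq_bigr do rewrite inner_scalel//.
rewrite (bigD1_seq k) ?mem_index_iota ?iota_uniq//=.
rewrite big1 ?addr0// => i ik.
by rewrite b_orth// mulr0.
Qed.

(** Pythagoras: orthogonality kills the cross terms. *)
Lemma inner_sqr_block m n :
  << block m n, block m n >> = \sum_(m <= i < n) a i ^+ 2 * << b i, b i >>.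
Proof.
rewrite {1}/block inner_suml => [|i|//]; last exact: L2_scale.
apply: eq_big_nat => i mn.
by rewrite inner_scalel// innerC inner_block_basis// mulrA expr2.
Qed.

Lemma residual_orthogonal N k : (k < N)%N -> << f - block 0 N, b k >> = 0.
Proof. by move=> kN; rewrite innerBl// inner_block_basis// aE subrr. Qed.

Lemma residual_orthogonal_block N : << f - block 0 N, block 0 N >> = 0.
Proof.
rewrite innerC {1}/block inner_suml => [|i|]; [|exact: L2_scale|exact: L2_sub].
rewrite big_nat big1// => i iN.
by rewrite inner_scalel ?L2_sub// innerC residual_orthogonal ?mulr0.
Qed.

(** Pythagoras for [f] split into its residual and the partial sum, which are orthogonal. *)
Lemma Bessel_inequality N :
  \sum_(0 <= i < N) a i ^+ 2 * << b i, b i >> <= << f, f >>.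
Proof.
rewrite -inner_sqr_block.
have := inner_sqrD (L2_sub f2 (block2 0 N)) (block2 0 N).
rewrite subrK residual_orthogonal_block mulr0 addr0 => ->.
by rewrite lerDr inner_ge0.
Qed.

(** The squared distance between two partial sums is a block of the series of
    [a i ^+ 2 * << b i, b i >>], which converges because it is nondecreasing and bounded by
    Bessel. *)
Lemma expansion_cauchy e : 0 < e -> exists N, forall m n, (N <= n <= m)%N ->
  << block 0 m - block 0 n, block 0 m - block 0 n >> <= e.
Proof.
move=> e0; pose s := series (fun i => a i ^+ 2 * << b i, b i >>).
have s_nd : nondecreasing_seq s.
  by apply: nondecreasing_series => i _ _; rewrite mulr_ge0 ?sqr_ge0 ?inner_ge0.
have : cvgn s.
  apply: nondecreasing_is_cvgn => //; exists << f, f >> => _ [n _ <-].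
  exact: Bessel_inequality.
move=> /cauchy_cvgP/cauchy_seriesP/(_ e e0).
rewrite -near2_pair => -[[A B] /= [[N _ NA] [M _ MB]] AB].
exists (maxn N M) => m n /andP[]; rewrite geq_max => /andP[Nn Mn] nm.
rewrite (_ : _ - _ = block n m); last first.
  by apply/eqP; rewrite subr_eq addrC /block -big_cat_nat.
have /= := AB (n, m) (conj (NA _ Nn) (MB _ (leq_trans Mn nm))).
by rewrite inner_sqr_block => /ltW; apply: le_trans; rewrite ler_norm.
Qed.

(** The residual [r] is orthogonal to [block 0 N] and to [g], hence to their difference [h];
    Pythagoras applies to [f - g = r + h]. *)
Lemma best_approximation N g : g \in L2 -> << f - block 0 N, g >> = 0 ->
  << f - block 0 N, f - block 0 N >> <= << f - g, f - g >>.
Proof.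
move=> g2 fg; set r := f - block 0 N; pose h := block 0 N - g.
have r2 : r \in L2 by exact: L2_sub.
have h2 : h \in L2 by exact: L2_sub.
have rh : << r, h >> = 0.
  rewrite innerC innerBl// innerC residual_orthogonal_block.
  by rewrite innerC fg subrr.
have -> : f - g = r + h by rewrite /r /h addrA subrK.
by rewrite inner_sqrD// rh mulr0 addr0 lerDl inner_ge0.
Qed.

End orthogonal_expansion.

(** * Limits of real and extended-real sequences *)

Lemma is_cvg_series_nneseries (R : realType) (u : nat -> R) :
  (forall n, 0 <= u n) -> (\sum_(n <oo) (u n)%:E < +oo)%E -> cvgn (series u).
Proof.
move=> u0 uoo; apply: nondecreasing_is_cvgn.
  by apply: nondecreasing_series => n _ _.
exists (fine (\sum_(n <oo) (u n)%:E)%E) => _ [n _ <-].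
have s0 : (0 <= \sum_(n <oo) (u n)%:E)%E by apply: nneseries_ge0 => k _ _; rewrite lee_fin.
rewrite -lee_fin fineK; last by rewrite ge0_fin_numE.
rewrite /series/= -sumEFin.
by apply: nneseries_lim_ge => k _ _; rewrite lee_fin.
Qed.

(** An eventual bound is what is available after Fatou's lemma, where the integrals are controlled
    only for large indices. *)
Lemma limn_einf_le (R : realType) (u : (\bar R)^nat) (l : \bar R) :
  (\forall n \near \oo, u n <= l)%E -> (limn_einf u <= l)%E.
Proof.
move=> ul; rewrite limn_einf_lim; apply: lime_le; first exact: is_cvg_einfs.
apply: filterS ul => n; apply: le_trans.
by apply: ereal_inf_lbound; exists n => /=.
Qed.

Lemma cvg_telescope_norm (R : realType) (v : nat -> R) :
  cvgn [normed series (telescope v)] -> cvgn v.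
Proof.
move=> /normed_cvg tv.
rewrite (_ : v = (fun n => v 0%N + series (telescope v) n)); last first.
  by apply/funext => n; exact: eq_sum_telescope.
by apply: is_cvgD => //; exact: is_cvg_cst.
Qed.

(** * Completeness of L2 (Riesz-Fischer) *)

Section L2_complete.
Context d (T : measurableType d) (R : realType).
Variable mu : {measure set T -> \bar R}.
Local Notation L2 := (Lfun mu 2%:E).
Local Notation "<< f , g >>" := (inner mu f g).

(** Weights of total mass 1, written in the shape of [epsilon_trick0]. *)
Let w (j : nat) : R := 1 / (2 ^ j.+1)%:R.

Let w_gt0 j : 0 < w j.
Proof. by rewrite divr_gt0// ltr0n expn_gt0. Qed.

(* The weights [w j] trade square summability for absolute summability:
   [`|t| <= w j + t ^+ 2 / w j]. *)
Lemma ae_cvg_fast_cauchy (v : nat -> T -> R) : (forall n, v n \in L2) ->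
  (forall j, << v j.+1 - v j, v j.+1 - v j >> <= w j ^+ 2) ->
  {ae mu, forall x, cvgn (v ^~ x)}.
Proof.
move=> v2 vw; pose q j x := (v j.+1 x - v j x) ^+ 2 / w j.
have dv2 j : v j.+1 - v j \in L2 by exact: L2_sub.
have q0 j x : 0 <= q j x by rewrite divr_ge0 ?sqr_ge0// ltW.
have mq j : measurable_fun setT (q j).
  apply: measurable_funM => //; apply: measurable_funX.
  exact: L2_measurable (dv2 j).
have mq' j : measurable_fun setT (EFin \o q j) by exact/measurable_EFinP.
(* Sum and integral commute by nonnegativity; the [j]-th term is at most [w j ^+ 2 / w j = w j], and
   the weights sum to at most 1. *)
have intq : (\int[mu]_x (\sum_(j <oo) (q j x)%:E) <= 1)%E.
  rewrite integral_nneseries//; last by move=> *; rewrite lee_fin.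
  apply: le_trans (epsilon_trick0 predT (@ler01 R)); apply: lee_nneseries.
    by move=> j _ _; apply: integral_ge0 => x _; rewrite lee_fin.
  move=> j _; rewrite /q.
  under eq_integral do rewrite mulrC EFinM.
  rewrite ge0_integralZl_EFin//; last first.
  - by rewrite invr_ge0 ltW.
  - apply/measurable_EFinP; apply: measurable_funX.
    exact: L2_measurable (dv2 j).
  - by move=> x _; rewrite lee_fin sqr_ge0.
  rewrite (inner_sqrE (dv2 j)) -EFinM lee_fin.
  by rewrite ler_pdivrMl// -expr2.
have Q0 x : (0 <= \sum_(j <oo) (q j x)%:E)%E.
  by apply: nneseries_ge0 => j _ _; rewrite lee_fin.
have iQ : mu.-integrable setT (fun x => (\sum_(j <oo) (q j x)%:E)%E).
  apply/integrableP; split.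
    apply: (@ge0_emeasurable_sum _ _ _ _ (fun j x => (q j x)%:E) xpredT) => //.
      by move=> j x _ _; rewrite lee_fin.
    by move=> j _; exact: mq'.
  under eq_integral do rewrite gee0_abs//.
  by rewrite (le_lt_trans intq)// ltry.
(* An integrable function is finite almost everywhere, so the series of the [q j x] converges for
   almost every [x]. *)
apply: filterS (integrable_ae measurableT iQ) => x /(_ I) Qx.
apply: cvg_telescope_norm.
apply: (@series_le_cvg _ _ (fun j => w j + q j x)) => [n|n|n|].
- by rewrite /= normr_ge0.
- by rewrite addr_ge0// ltW.
- rewrite /telescope/= /q; set t := v _ _ - v _ _.
  have wn := w_gt0 n.
  rewrite -(@ler_pM2r _ (w n))// mulrDl divfK ?gt_eqF//.
  rewrite -real_normK ?num_real//; nra.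
- rewrite -[X in series X]/((w : nat -> R) + q ^~ x).
  apply: is_cvg_seriesD; apply: is_cvg_series_nneseries.
  + by move=> n; rewrite ltW.
  + exact: le_lt_trans (epsilon_trick0 predT (@ler01 R)) (ltry _).
  + by [].
  + by rewrite -ge0_fin_numE.
Qed.

(** A rapidly Cauchy subsequence converges almost everywhere; Fatou's lemma then transfers the
    Cauchy bounds of the whole sequence to its distance from the pointwise limit. *)
Theorem L2_complete (u : nat -> T -> R) : (forall n, u n \in L2) ->
  (forall e, 0 < e -> exists N, forall m n, (N <= n <= m)%N ->
     << u m - u n, u m - u n >> <= e) ->
  exists2 S, S \in L2 & << u n - S, u n - S >> @[n --> \oo] --> 0.
Proof.
move=> u2 uC.
have /choice[N NP] : forall j, exists N, forall m n, (N <= n <= m)%N ->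
    << u m - u n, u m - u n >> <= w j ^+ 2.
  by move=> j; apply: uC; rewrite exprn_gt0.
(* Summing the successors [(N i).+1] makes [phi] increasing and at least both [N j] and [j]. *)
pose phi j := (\sum_(i < j.+1) (N i).+1)%N.
have phiS j : phi j.+1 = (phi j + (N j.+1).+1)%N by rewrite /phi big_ord_recr.
have Nphi j : (N j <= phi j)%N.
  by rewrite /phi big_ord_recr/= (leq_trans _ (leq_addl _ _)).
have le_phi j : (j <= phi j)%N.
  by elim: j => [//|k IH]; rewrite phiS addnS ltnS (leq_trans IH)// leq_addr.
pose v j := u (phi j).
have v_ae : {ae mu, forall x, cvgn (v ^~ x)}.
  apply: ae_cvg_fast_cauchy => [n|j]; first exact: u2.
  by apply: NP; rewrite Nphi phiS leq_addr.
(* The upper limit is measurable without any convergence, and agrees with the limit wherever [v]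
   converges. *)
pose S x := fine (limn_esup (fun k => (v k x)%:E)).
have mu_n n : measurable_fun setT (u n) by exact: L2_measurable (u2 n).
have mS : measurable_fun setT S.
  apply: measurableT_comp => //.
  by apply: measurable_fun_limn_esup => n; exact/measurable_EFinP/mu_n.
have vS : {ae mu, forall x, v k x @[k --> \oo] --> S x}.
  apply: filterS v_ae => x cvx.
  suff -> : S x = limn (v ^~ x) by [].
  have : (v k x)%:E @[k --> \oo] --> (limn (v ^~ x))%:E.
    by apply: cvg_EFin; [exact: nearW|].
  by rewrite /S => /cvg_limn_einf_sup[_ ->].
(* Fatou: almost everywhere [(S - u n) ^+ 2] is the lower limit of the [(v k - u n) ^+ 2], whose
   integrals are at most [e] for [k >= n], since [phi k >= k]. *)
have Sle n e : (forall m, (n <= m)%N -> << u m - u n, u m - u n >> <= e) ->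
    (\int[mu]_x (((S - u n) x) ^+ 2)%:E <= e%:E)%E.
  move=> ne.
  have mvn k : measurable_fun setT (fun x => (((v k - u n) x) ^+ 2)%:E).
    by apply/measurable_EFinP/measurable_funX/L2_measurable/L2_sub; exact: u2.
  rewrite (@ge0_ae_eq_integral _ _ _ _ _ _
      (fun x => limn_einf (fun k => (((v k - u n) x) ^+ 2)%:E)))//.
  - apply: le_trans (fatou _ _ _ _) _ => //.
      by move=> k x _; rewrite lee_fin sqr_ge0.
    apply: limn_einf_le; exists n => // k /= nk.
    rewrite inner_sqrE ?lee_fin; last by apply: L2_sub; exact: u2.
    by apply: ne; exact: leq_trans (le_phi k).
  - by apply/measurable_EFinP/measurable_funX/measurable_funB.
  (* Measurability of the lower limit is reduced to that of an upper limit by a change of sign. *)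
  - under eq_fun do rewrite -[limn_einf _]oppeK -limn_esupN.
    apply: measurableT_comp => //; apply: measurable_fun_limn_esup => k.
    by apply: measurableT_comp.
  - by move=> x _; rewrite lee_fin sqr_ge0.
  - move=> x _; rewrite limn_einf_lim; apply: lime_ge; first exact: is_cvg_einfs.
    apply: nearW => k; apply: le_ereal_inf_tmp => _ [m _ <-].
    by rewrite lee_fin sqr_ge0.
  - apply: filterS vS => x vSx _ /=; symmetry.
    have : (((v k - u n) x) ^+ 2)%:E @[k --> \oo] --> (((S - u n) x) ^+ 2)%:E.
      apply: cvg_EFin; first exact: nearW.
      by apply: cvgM; apply: cvgB => //; exact: cvg_cst.
    by move=> /cvg_limn_einf_sup[].
have SN2 n e : (forall m, (n <= m)%N -> << u m - u n, u m - u n >> <= e) ->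
    S - u n \in L2.
  move=> /Sle Se; apply: L2P; first by apply: measurable_funB.
  exact: le_lt_trans Se (ltry _).
have S2 : S \in L2.
  have [M MP] := uC 1 ltr01.
  rewrite -[S](subrK (u M)) L2_add// (SN2 M 1)// => m Mm.
  by apply: MP; rewrite leqnn.
exists S => //; apply/cvgrPdist_le => e e0.
have [M MP] := uC e e0.
exists M => // n /= Mn; rewrite sub0r normrN ger0_norm ?inner_ge0//.
have -> : << u n - S, u n - S >> = << S - u n, S - u n >>.
  by apply: eq_Rintegral => x _ /=; rewrite -mulrNN !opprB.
rewrite -lee_fin -inner_sqrE ?L2_sub//.
by apply: Sle => m nm; apply: MP; rewrite Mn.
Qed.

End L2_complete.

(** A multiple of [b N] cancels the coefficient of degree [N], which lowers the size. The abstract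
    [P] serves both for square-integrability and for orthogonality. *)
Lemma poly_graded_ind (F : fieldType) (b : nat -> {poly F})
    (P : {poly F} -> Prop) (N : nat) :
  (forall n, size (b n) = n.+1) ->
  P 0 -> (forall a p q, P p -> P q -> P (a *: p + q)) ->
  (forall n, (n < N)%N -> P (b n)) -> forall p : {poly F}, (size p <= N)%N -> P p.
Proof.
move=> sb P0 PD; elim: N => [|N IH] Pb p.
  by rewrite leqn0 size_poly_eq0 => /eqP ->.
move=> sp; pose a := p`_N / lead_coef (b N); pose q := p - a *: b N.
have bN0 : lead_coef (b N) != 0 by rewrite lead_coef_eq0 -size_poly_gt0 sb.
have -> : p = a *: b N + q by rewrite /q addrC subrK.
apply: PD; first exact: Pb.
apply: IH => [n nN|]; first by apply: Pb; exact: ltnW.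
apply/leq_sizeP => j; rewrite leq_eqVlt => /predU1P[<-|Nj].
  have bNN : (b N)`_N = lead_coef (b N) by rewrite lead_coefE sb.
  by rewrite coefB coefZ bNN divfK ?subrr.
rewrite coefB coefZ !nth_default ?sb ?mulr0 ?subrr//.
exact: leq_trans sp Nj.
Qed.

(** * Mean-square convergence through squared norms *)

Section cvg_L2.
Context (R : realType) (nu : probability (measurableTypeR R) R).
Local Notation L2 := (Lfun nu 2%:E).
Local Notation "<< f , g >>" := (inner nu f g).

Lemma cvg_L2_inner (u : nat -> R -> R) (S : R -> R) :
  (forall n, u n \in L2) -> S \in L2 ->
  << u n - S, u n - S >> @[n --> \oo] --> 0 -> cvg_L2 nu u S.
Proof.
move=> u2 S2 uS; rewrite /cvg_L2.
under eq_cvg => n do rewrite (Lnorm2E (L2_sub (u2 n) S2)).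
apply: cvg_EFin; first exact: nearW.
rewrite -[X in _ --> X]sqrtr0.
by apply: continuous_cvg => //; exact: sqrt_continuous.
Qed.

End cvg_L2.

(** * Polynomials as elements of L2 *)

Section orthogonal_polynomials.
Context (R : realType) (m : probability (measurableTypeR R) R).
Variable p : nat -> {poly R}.
Hypothesis pP : orthogonal_polynomials m p.
Local Notation L2 := (Lfun m 2%:E).
Local Notation "<< f , g >>" := (inner m f g).

Lemma horner_scaleD a (q r : {poly R}) :
  horner (a *: q + r) = a *: (horner q) + horner r.
Proof. by apply/funext => x; rewrite !hornerE. Qed.

Lemma horner_fct0 : horner (0 : {poly R}) = 0.
Proof. by apply/funext => x; rewrite horner0. Qed.

(** Having one member in each degree, the family spans all polynomials, which inherit its
    square-integrability. *)
Lemma horner_L2 (q : {poly R}) : horner q \in L2.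
Proof.
have [sp p2 _] := pP.
apply: (@poly_graded_ind _ p (fun q => horner q \in L2) (size q)) => //.
  by rewrite horner_fct0; exact: L2_0.
by move=> a r s r2 s2; rewrite horner_scaleD; exact: L2_scaleD.
Qed.

(** A polynomial is a combination of the [p n] of degree at most its own, so only these need
    testing. *)
Lemma inner_horner0 f (q : {poly R}) : f \in L2 ->
  (forall n, (n < size q)%N -> << f, horner (p n) >> = 0) ->
  << f, horner q >> = 0.
Proof.
move=> f2 fp; have [sp p2 _] := pP.
apply: (@poly_graded_ind _ p (fun q => << f, horner q >> = 0) (size q)) => //.
  by rewrite horner_fct0 innerC inner0l.
move=> a r s r2 s2; rewrite horner_scaleD innerC inner_scaleDl//.
- by rewrite innerC r2 innerC s2 mulr0 addr0.
- exact: horner_L2.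
- exact: horner_L2.
Qed.

End orthogonal_polynomials.

(** * The density as an element of L2 and the change of measure *)

Section RN_derivative_L2.
Context (R : realType) (mu nu : probability (measurableTypeR R) R).
Hypothesis munu : mu `<< nu.
Local Notation f := (RN_derivative mu nu).

Lemma RN_derivativeE x :
  ('d (charge_of_finite_measure mu) '/d nu) x = (f x)%:E.
Proof. by rewrite fineK// Radon_Nikodym_fin_num. Qed.

Lemma RN_derivative_L2 :
  (\int[nu]_x (('d (charge_of_finite_measure mu) '/d nu) x ^+ 2) < +oo)%E ->
  f \in Lfun nu 2%:E.
Proof.
move=> f2; apply: L2P.
  exact: measurableT_comp.
by under eq_integral do rewrite EFin_expe -RN_derivativeE.
Qed.

Lemma inner_RN_derivative g : mu.-integrable setT (EFin \o g) ->
  inner nu f g = \int[mu]_x g x.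
Proof.
move=> ig; rewrite /inner /Rintegral; congr fine.
rewrite -(Radon_Nikodym_change_of_variables munu measurableT ig).
by apply: eq_integral => x _; rewrite RN_derivativeE -EFinM mulrC.
Qed.

End RN_derivative_L2.

(** * Convergence of the expansion of the density *)

Theorem theorem1 (R : realType) (mu nu : probability (measurableTypeR R) R)
    (alpha beta : nat -> {poly R}) (c : nat -> nat -> R)
    (munu : mu `<< nu) (numu : nu `<< mu)
    (sqint : (\int[nu]_x (('d (charge_of_finite_measure mu) '/d nu) x ^+ 2)
              < +oo)%E)
    (alphaP : orthogonal_polynomials mu alpha) (alpha0 : alpha 0%N = 1)
    (betaP : orthogonal_polynomials nu beta)
    (connection : forall n,
      beta n = \sum_(0 <= k < n.+1) c n k *: alpha k) :
  (polynomials_dense_L2 nu ->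
     cvg_L2 nu (expansion_sum nu beta c) (RN_derivative mu nu)) /\
  (exists S : R -> R,
    [/\ S \in Lfun nu 2%:E,
        cvg_L2 nu (expansion_sum nu beta c) S &
        forall p : {poly R},
          \int[nu]_x ((RN_derivative mu nu x - S x) * p.[x]) = 0]).
Proof.
set f := RN_derivative mu nu; pose a := expansion_coef nu beta c.
have f2 : f \in Lfun nu 2%:E by exact: RN_derivative_L2.
have [_ beta2 beta_orth] := betaP; have [_ _ alpha_orth] := alphaP.
have mu_alpha k : \int[mu]_x (alpha k).[x] = (k == 0%N)%:R.
  have [->|k0] := eqVneq k 0%N.
    under eq_Rintegral do rewrite alpha0 hornerE.
    have muT : mu setT = 1%E by exact: probability_setT.
    rewrite Rintegral_cst// mul1r; exact: (congr1 fine muT : _ = 1).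
  (* The mean of [alpha k] is its product with [alpha 0 = 1], which vanishes by orthogonality. *)
  rewrite -[RHS](alpha_orth _ _ k0); apply: eq_Rintegral => x _.
  by rewrite alpha0 !hornerE.
have mu_int q : mu.-integrable setT (EFin \o horner q).
  apply/Lfun1_integrable/Lfun_subset12/(horner_L2 alphaP).
  by rewrite fin_num_measure.
have mu_scaleD t q r : \int[mu]_x (t *: q + r).[x] =
    t * \int[mu]_x q.[x] + \int[mu]_x r.[x].
  rewrite -(RintegralZl t measurableT (mu_int q)) -RintegralD//.
  - by apply: eq_Rintegral => x _; rewrite !hornerE.
  - have := mu_int (t *: q); apply: eq_integrable => // x _ /=.
    by rewrite hornerE.
have f_beta n : inner nu f (horner (beta n)) = c n 0%N.
  rewrite inner_RN_derivative// connection.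
  transitivity (\sum_(0 <= k < n.+1) c n k * \int[mu]_x (alpha k).[x]); last first.
    rewrite big_nat_recl//= mu_alpha mulr1 big1 ?addr0// => k _.
    by rewrite mu_alpha mulr0.
  (* Linearity of the integral, by induction on an arbitrary list of indices. *)
  elim: (index_iota 0 n.+1) => [|k s IH].
    rewrite !big_nil; under eq_Rintegral do rewrite hornerE.
    by rewrite Rintegral_cst// mul0r.
  by rewrite !big_cons mu_scaleD IH.
have sqnormE n : sqnorm nu beta n = inner nu (horner (beta n)) (horner (beta n)).
  by apply: eq_Rintegral => x _; rewrite expr2.
have aE n : a n * inner nu (horner (beta n)) (horner (beta n)) =
    inner nu f (horner (beta n)).
  rewrite f_beta /a /expansion_coef sqnormE.
  (* If [beta n] has norm zero, the left side is 0, and Cauchy-Schwarz forces [c n 0 = 0] on the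
     right. *)
  have [n0|n0] := eqVneq (inner nu (horner (beta n)) (horner (beta n))) 0.
    have := Cauchy_Schwarz f2 (beta2 n); rewrite f_beta n0 mulr0 => c0.
    by rewrite mulr0; apply/esym/eqP; rewrite -sqrf_eq0 eq_le c0 sqr_ge0.
  by rewrite divfK.
have expansionE : expansion_sum nu beta c =
    fun N => \sum_(0 <= n < N) a n *: horner (beta n).
  apply/funext => N; apply/funext => x.
  by rewrite /expansion_sum fct_sumE.
have expansion2 N : expansion_sum nu beta c N \in Lfun nu 2%:E.
  by rewrite expansionE; apply: L2_sum => n; exact: L2_scale.
have residual N (q : {poly R}) : (size q <= N)%N ->
    inner nu (f - expansion_sum nu beta c N) (horner q) = 0.
  move=> qN; apply: (inner_horner0 betaP); first exact: L2_sub.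
  move=> n nq; rewrite expansionE; apply: residual_orthogonal => //.
  exact: leq_trans qN.
split=> [dense|].
  apply: cvg_L2_inner => //; apply/cvgrPdist_le => e e0.
  (* Density is stated for the norm while the bound sought is on its square, hence the square
     root. *)
  have [|q qe] := dense f f2 (Num.sqrt e); first by rewrite sqrtr_gt0.
  (* From this index on, [q] lies in the span of the [beta n] with [n < N], so the partial sum is at
     least as close to [f] as [q] is. *)
  exists (size q) => // N /= qN.
  rewrite sub0r normrN ger0_norm ?inner_ge0//.
  pose r := horner q - f; have r2 : r \in Lfun nu 2%:E.
    by apply: L2_sub => //; exact: horner_L2 betaP _.
  have {}qe : inner nu (f - horner q) (f - horner q) < e.
    move: qe; rewrite (Lnorm2E r2) lte_fin ltr_sqrt//.
    congr (_ < _); apply: eq_Rintegral => x _ /=.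
    by rewrite -mulrNN !opprB.
  apply/ltW/(le_lt_trans _ qe).
  rewrite (_ : inner _ _ _ = inner nu (f - expansion_sum nu beta c N)
      (f - expansion_sum nu beta c N)); last first.
    by apply: eq_Rintegral => x _ /=; rewrite -mulrNN !opprB.
  have := residual N q qN; rewrite expansionE.
  apply: best_approximation => //; exact: horner_L2 betaP _.
have [|S S2 SE] := L2_complete expansion2.
  rewrite expansionE; exact: (expansion_cauchy beta2 beta_orth f2 aE).
exists S; split=> //; first exact: cvg_L2_inner.
move=> q; rewrite -[LHS]/(inner nu (f - S) (horner q)).
have q2 := horner_L2 betaP q.
pose e N := inner nu (expansion_sum nu beta c N - S) (expansion_sum nu beta c N - S).
(* Split [f - S] at the partial sum of index [N]: the residual is orthogonal to [q], and
   Cauchy-Schwarz bounds the other part by [e N], which tends to 0. *)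
have bound N : (size q <= N)%N ->
    inner nu (f - S) (horner q) ^+ 2 <= e N * inner nu (horner q) (horner q).
  move=> qN; have -> : inner nu (f - S) (horner q) =
      inner nu (expansion_sum nu beta c N - S) (horner q).
    apply/eqP; rewrite -subr_eq0 -innerBl ?L2_sub//.
    by rewrite opprB addrA subrK residual.
  by apply: Cauchy_Schwarz => //; exact: L2_sub.
have eq0 : e N * inner nu (horner q) (horner q) @[N --> \oo] --> 0.
  rewrite -[X in _ --> X](mul0r (inner nu (horner q) (horner q))).
  by apply: cvgM => //; exact: cvg_cst.
apply/eqP; rewrite -sqrf_eq0 eq_le sqr_ge0 andbT.
by apply: (cvgr_to_ge eq0); exists (size q) => // N; exact: bound.
Qed.
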